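(* Let $\widetilde{W}$ be an (irreducible) affine Weyl group. If $\mathbf{i}$ is a fully commutative infinite reduced word of $\widetilde{W}$, then $[\mathbf{i}]$ is a minimal element of the limit weak order $\widetilde{\mathcal{W}}$.
   Context: $\widetilde{W}$ is the affine Weyl group of an irreducible reduced crystallographic root system, viewed as a Coxeter group with simple reflections $s_0,s_1,\dots,s_n$ and Coxeter matrix $(m_{ij})$. Limit weak order. An infinite reduced word of $\widetilde{W}$ is a sequence $\mathbf{i}=i_1i_2\cdots$ in $\{0,\dots,n\}$ such that every finite prefix $s_{i_1}\cdots s_{i_k}$ is a reduced word. Its inversion set $\mathrm{Inv}(\mathbf{i})$ is the set of reflections $s_{i_1}\cdots s_{i_{k-1}}s_{i_k}s_{i_{k-1}}\cdots s_{i_1}$, $k\ge1$. $[\mathbf{i}]$ denotes the class of $\mathbf{i}$, where $[\mathbf{i}]=[\mathbf{j}]$ iff $\mathrm{Inv}(\mathbf{i})=\mathrm{Inv}(\mathbf{j})$; such classes are called limit elements. The limit weak order $\widetilde{\mathcal{W}}$ is the set of limit elements partially ordered by containment of inversion sets. Full commutativity. An element $w\in\widetilde W$ is fully commutative if no reduced word of $w$ admits a braid move, i.e. the replacement of a consecutive factor $s_is_js_i\cdots$ ($m_{ij}$ letters) by $s_js_is_j\cdots$ ($m_{ij}$ letters) with $3\le m_{ij}<\infty$. An infinite reduced word $\mathbf{i}$ is fully commutative if all the elements $s_{i_1}\cdots s_{i_k}$, $k\ge1$, are fully commutative. *)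

(* Defs.v *)
From HB Require Import structures.
From mathcomp Require Import all_boot all_order all_algebra generic_quotient.
From mathcomp Require Import boolp classical_sets reals.

Set Implicit Arguments.
Unset Strict Implicit.
Unset Printing Implicit Defensive.

Import Order.TTheory GRing.Theory Num.Theory.

Local Open Scope classical_set_scope.
Local Open Scope quotient_scope.
Local Open Scope ring_scope.

(** * Root systems in the Euclidean space R^n *)

Definition dot (R : realType) (n : nat) (u v : 'rV[R]_n) : R :=
  \sum_(j < n) u 0 j * v 0 j.

(** The orthogonal reflection in the hyperplane (x, a) = k. *)
Definition affine_reflection (R : realType) (n : nat) (a : 'rV[R]_n) (k : R)
    (x : 'rV[R]_n) : 'rV[R]_n :=
  x - (2 * (dot x a - k) / dot a a) *: a.

Record root_system (R : realType) (n : nat) (Phi : seq 'rV[R]_n) : Prop :=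
  RootSystem {
    root_span : (<<Phi>> = fullv)%VS;
    root_neq0 : 0 \notin Phi;
    root_refl : {in Phi &, forall a b, affine_reflection a 0 b \in Phi}
  }.

Definition reduced_roots (R : realType) (n : nat) (Phi : seq 'rV[R]_n) : Prop :=
  {in Phi, forall a (c : R), c *: a \in Phi -> c = 1 \/ c = -1}.

Definition crystallographic (R : realType) (n : nat) (Phi : seq 'rV[R]_n) :
    Prop :=
  {in Phi &, forall a b, 2 * dot b a / dot a a \is a Num.int}.

(** [Phi] is nonempty and is not the union of two nonempty, mutually
    orthogonal subsets. *)
Definition irreducible_roots (R : realType) (n : nat) (Phi : seq 'rV[R]_n) :
    Prop :=
  Phi <> [::] /\
  forall p : pred 'rV[R]_n,
    {in Phi &, forall a b, p a -> ~~ p b -> dot a b = 0} ->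
    all p Phi \/ all (predC p) Phi.

Definition nneg_comb (R : realType) (n : nat) (alpha : n.-tuple 'rV[R]_n)
    (b : 'rV[R]_n) : Prop :=
  exists c : 'I_n -> nat, b = \sum_(j < n) (c j)%:R *: tnth alpha j.

Record simple_system (R : realType) (n : nat) (Phi : seq 'rV[R]_n)
    (alpha : n.-tuple 'rV[R]_n) : Prop :=
  SimpleSystem {
    simple_root : {subset alpha <= Phi};
    simple_basis : basis_of fullv alpha;
    simple_comb : {in Phi, forall b, nneg_comb alpha b \/ nneg_comb alpha (- b)}
  }.

Definition highest_root (R : realType) (n : nat) (Phi : seq 'rV[R]_n)
    (alpha : n.-tuple 'rV[R]_n) (theta : 'rV[R]_n) : Prop :=
  theta \in Phi /\ {in Phi, forall b, nneg_comb alpha (theta - b)}.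

(** The affine Weyl group of [Phi] is the group of affine transformations of
    R^n generated by the following simple reflections: s_0 is the reflection in
    (x, theta) = 1, and s_1, ..., s_n are those in the hyperplanes orthogonal to
    the simple roots.  Its elements are represented as maps from R^n to
    itself, the product being composition. *)
Definition affine_simple_reflection (R : realType) (n : nat)
    (alpha : n.-tuple 'rV[R]_n) (theta : 'rV[R]_n) (i : 'I_n.+1) :
    'rV[R]_n -> 'rV[R]_n :=
  if unlift ord0 i is Some j then affine_reflection (tnth alpha j) 0
  else affine_reflection theta 1.

(** * Words in a family of generators [s], acting on a type [V] *)

Definition word_prod (V : Type) (I : choiceType) (s : I -> V -> V)
    (w : seq I) : V -> V :=
  foldr (fun i f => s i \o f) id w.

Definition reduced_word (V : Type) (I : choiceType) (s : I -> V -> V)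
    (w : seq I) : Prop :=
  forall u : seq I, word_prod s u = word_prod s w -> (size w <= size u)%N.

(** The Coxeter matrix: [coxeter_entry s i j] is the order of s_i s_j, with 0
    standing for infinite order. *)
Definition is_period (V : Type) (f : V -> V) (m : nat) : bool :=
  `[< (0 < m)%N /\ iter m f =1 id >].

Definition coxeter_entry (V : Type) (I : choiceType) (s : I -> V -> V)
    (i j : I) : nat :=
  if pselect (exists m, is_period (s i \o s j) m) is left ex then ex_minn ex
  else 0%N.

(** The word i j i ... with [m] letters. *)
Definition alternating (I : choiceType) (i j : I) (m : nat) : seq I :=
  mkseq (fun k => if odd k then j else i) m.

(** Infinite entries of the Coxeter matrix, being encoded by 0, are excluded by
    the condition [3 <= m]. *)
Definition admits_braid_move (V : Type) (I : choiceType) (s : I -> V -> V)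
    (w : seq I) : Prop :=
  exists i j : I, (3 <= coxeter_entry s i j)%N /\
    infix (alternating i j (coxeter_entry s i j)) w.

Definition fully_commutative (V : Type) (I : choiceType) (s : I -> V -> V)
    (g : V -> V) : Prop :=
  forall w : seq I, reduced_word s w -> word_prod s w = g ->
    ~ admits_braid_move s w.

(** * Infinite reduced words and the limit weak order *)

Record infinite_reduced_word (V : Type) (I : choiceType) (s : I -> V -> V) :=
  InfiniteReducedWord {
    letter :> nat -> I;
    letterP : `[< forall k, reduced_word s (mkseq letter k) >]
  }.

HB.instance Definition _ (V : Type) (I : choiceType) (s : I -> V -> V) :=
  [isSub for @letter V I s].
HB.instance Definition _ (V : Type) (I : choiceType) (s : I -> V -> V) :=
  [Choice of infinite_reduced_word s by <:].

Definition fully_commutative_word (V : Type) (I : choiceType) (s : I -> V -> V)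
    (i : infinite_reduced_word s) : Prop :=
  forall k, (1 <= k)%N -> fully_commutative s (word_prod s (mkseq i k)).

(** Letters are indexed from 0, so that the k-th term below is the reflection
    s_(i 0) ... s_(i (k-1)) s_(i k) s_(i (k-1)) ... s_(i 0). *)
Definition inversion_set (V : Type) (I : choiceType) (s : I -> V -> V)
    (i : infinite_reduced_word s) : set (V -> V) :=
  [set t | exists k : nat,
     t = word_prod s (mkseq i k ++ i k :: rev (mkseq i k))].

Definition same_inversions (V : Type) (I : choiceType) (s : I -> V -> V) :
    rel (infinite_reduced_word s) :=
  fun i j => `[< inversion_set i = inversion_set j >].

Lemma same_inversions_equiv (V : Type) (I : choiceType) (s : I -> V -> V) :
  equiv_class_of (@same_inversions V I s).
Proof.
split.
- by move=> i; apply/asboolP.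
- by move=> i j; apply/asboolP/asboolP => ->.
- by move=> j i k /asboolP ij /asboolP jk; apply/asboolP; rewrite ij.
Qed.

Canonical same_inversions_equiv_rel (V : Type) (I : choiceType)
    (s : I -> V -> V) :=
  EquivRelPack (same_inversions_equiv s).

Definition limit_element (V : Type) (I : choiceType) (s : I -> V -> V) :=
  {eq_quot @same_inversions V I s}.

HB.instance Definition _ (V : Type) (I : choiceType) (s : I -> V -> V) :=
  Choice.on (limit_element s).
HB.instance Definition _ (V : Type) (I : choiceType) (s : I -> V -> V) :=
  EqQuotient.on (limit_element s).

Definition limit_class (V : Type) (I : choiceType) (s : I -> V -> V)
    (i : infinite_reduced_word s) : limit_element s :=
  \pi_(limit_element s) i.

Lemma limit_class_eq (V : Type) (I : choiceType) (s : I -> V -> V)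
    (i j : infinite_reduced_word s) :
  limit_class i = limit_class j <-> inversion_set i = inversion_set j.
Proof.
by split=> [/eqmodP/asboolP|ij]; last by apply/eqmodP/asboolP.
Qed.

Definition limit_inversion_set (V : Type) (I : choiceType) (s : I -> V -> V)
    (x : limit_element s) : set (V -> V) :=
  inversion_set (repr x).

Lemma limit_inversion_set_class (V : Type) (I : choiceType) (s : I -> V -> V)
    (i : infinite_reduced_word s) :
  limit_inversion_set (limit_class i) = inversion_set i.
Proof. by apply/limit_class_eq; rewrite /limit_class reprK. Qed.

Definition limit_le (V : Type) (I : choiceType) (s : I -> V -> V) :
    rel (limit_element s) :=
  fun x y => `[< limit_inversion_set x `<=` limit_inversion_set y >].

Lemma limit_le_refl (V : Type) (I : choiceType) (s : I -> V -> V) :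
  reflexive (@limit_le V I s).
Proof. by move=> x; apply/asboolP. Qed.

Lemma limit_le_anti (V : Type) (I : choiceType) (s : I -> V -> V) :
  antisymmetric (@limit_le V I s).
Proof.
move=> x y /andP[/asboolP xy /asboolP yx].
rewrite -[x]reprK -[y]reprK; apply/limit_class_eq.
by apply/seteqP; split.
Qed.

Lemma limit_le_trans (V : Type) (I : choiceType) (s : I -> V -> V) :
  transitive (@limit_le V I s).
Proof.
move=> y x z /asboolP xy /asboolP yz; apply/asboolP.
exact: subset_trans xy yz.
Qed.

Fact limit_weak_display : Order.disp_t. Proof. exact: Order.Disp tt tt. Qed.

(** The limit weak order is the type [limit_element s] with this order. *)
HB.instance Definition _ (V : Type) (I : choiceType) (s : I -> V -> V) :=
  Order.Le_isPOrder.Build limit_weak_display (limit_element s)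
    (@limit_le_refl V I s) (@limit_le_anti V I s) (@limit_le_trans V I s).

Lemma limit_class_leP (V : Type) (I : choiceType) (s : I -> V -> V)
    (i j : infinite_reduced_word s) :
  reflect (inversion_set i `<=` inversion_set j)
    (limit_class i <= limit_class j)%O.
Proof. by rewrite -!limit_inversion_set_class; apply: asboolP. Qed.

Definition minimal_element (d : Order.disp_t) (T : porderType d) (x : T) :
    Prop :=
  forall y : T, (y <= x)%O -> y = x.

(* Main.v *)
(** Suppose [Inv(j)] is contained in [Inv(i)] but misses some inversion of [i],
    and take the first such inversion: it comes from a letter [t] of [i]
    preceded by a prefix [u], with [Inv(u)] contained in [Inv(j)].  A long
    prefix of [j] is then [u v], and both [v] and [t] lie below [u^-1 p] in the
    weak order, for some prefix [p] of [i], while [t] does not lie below [v].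
    If two letters [a] and [t] are left descents of [y], then the longest
    element of the dihedral group they generate is a prefix of [y]; as
    [y = u^-1 p] is fully commutative, [a] and [t] commute.  Removing the
    letters of [v] one at a time, all of them commute with [t] and differ from
    it.  Hence [v], whose length is unbounded, lies in the parabolic subgroup
    omitting [t], which fixes a vertex of the fundamental alcove and is
    therefore finite. *)

Require Import Defs.
From mathcomp Require Import all_boot all_order all_algebra.
From mathcomp Require Import boolp classical_sets reals.
From mathcomp Require Import ring.

Set Implicit Arguments.
Unset Strict Implicit.
Unset Printing Implicit Defensive.

Import Order.TTheory GRing.Theory Num.Theory.

Local Open Scope ring_scope.

(** * Words and roots *)

Lemma word_prod_cat (V : Type) (I : choiceType) (s : I -> V -> V)
    (u w : seq I) x :
  word_prod s (u ++ w) x = word_prod s u (word_prod s w x).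
Proof. by elim: u => //= i u ->. Qed.

Lemma word_prod_rcons (V : Type) (I : choiceType) (s : I -> V -> V)
    (w : seq I) i x :
  word_prod s (rcons w i) x = word_prod s w (s i x).
Proof. by rewrite -cats1 word_prod_cat. Qed.

Lemma alternatingS (I : choiceType) (a b : I) m :
  alternating a b m.+1 = a :: alternating b a m.
Proof.
rewrite /alternating /mkseq /= -[1%N]addn0 iotaDl -map_comp; congr (_ :: _).
by apply: eq_map => k /=; case: (odd k).
Qed.

(* A geometric representation of the group generated by involutions [s]: the
   roots are real functions on the space on which the group acts, of constant
   sign on each chamber, and their signs are read off at a point of the
   fundamental chamber. *)
Record root_datum (R : realDomainType) (V : Type) (I : choiceType)
    (s : I -> V -> V) := RootDatum {
  base : V;
  root : (V -> R) -> Prop;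
  sroot : I -> V -> R;
  reflK : forall i, involutive (s i);
  root_opp : forall f, root f -> root (fun x => - f x);
  root_comp : forall f i, root f -> root (f \o s i);
  root_base : forall f, root f -> f base != 0;
  root_sroot : forall i, root (sroot i);
  sroot_base : forall i, 0 < sroot i base;
  sroot_refl : forall i x, sroot i (s i x) = - sroot i x;
  sroot_unique : forall f i,
    root f -> 0 < f base -> f (s i base) < 0 -> f = sroot i;
  sroot_conj : forall i j w, sroot i \o word_prod s w = sroot j ->
    s i \o word_prod s w = word_prod s w \o s j
}.

Section RootDatum.
Context (R : realDomainType) (V : Type) (I : choiceType) (s : I -> V -> V).
Context (D : root_datum R s).
Implicit Types (f : V -> R) (u v w y : seq I) (a b i j t : I).

Local Notation base := (base D).
Local Notation root := (root D).
Local Notation sroot := (sroot D).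
Local Notation P := (word_prod s).

Lemma root_base_le0 f : root f -> (f base < 0) = ~~ (0 < f base).
Proof.
by move=> /root_base f0; rewrite -leNgt le_eqVlt (negPf f0).
Qed.

Lemma word_prod_revK w : cancel (P w) (P (rev w)).
Proof.
elim: w => //= i w IHw x.
by rewrite rev_cons word_prod_rcons (reflK D) IHw.
Qed.

Lemma word_prod_revKr w : cancel (P (rev w)) (P w).
Proof. by move=> x; rewrite -{1}[w]revK word_prod_revK. Qed.

Lemma word_prod_rev u w : P u = P w -> (P (rev u)) = P (rev w).
Proof.
by move=> uw; apply/funext=> x; rewrite -{1}[x](word_prod_revKr w) -uw
  word_prod_revK.
Qed.

Lemma root_word f w : root f -> root (f \o P w).
Proof.
elim: w f => //= i w IHw f rf.
exact: (IHw (f \o s i)) (root_comp _ rf).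
Qed.

(** Follow the chambers of the prefixes of [w] from [base]. Where [f] first changes sign, the root
    seen from the current chamber is positive at [base] and negative one step further, so
    [sroot_unique] makes it simple. *)
Lemma root_exchange f w :
    root f -> 0 < f base -> f (P w base) < 0 ->
  exists w1 b w2, w = w1 ++ b :: w2 /\ f \o P w1 = sroot b.
Proof.
elim: w f => [|b w IHw] f rf f_gt0 /=.
  by rewrite ltNge ltW.
have [/(IHw (f \o s b) (root_comp b rf)) IH|] := boolP (0 < f (s b base)).
  by move=> /IH[w1 [c [w2 [-> fw]]]]; exists (b :: w1), c, w2.
rewrite -(root_base_le0 (root_comp b rf)) => fs _.
by exists [::], b, w; rewrite -(sroot_unique rf f_gt0 fs).
Qed.

(** The exchange condition: [root_exchange] locates the letter [b], and [sroot_conj] gives s_t w1 =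
    w1 s_b, so that a leading [t] can replace [b]. *)
Lemma exchange t w : sroot t (P w base) < 0 ->
  exists w1 b w2, [/\ w = w1 ++ b :: w2, sroot t \o P w1 = sroot b &
    P (t :: w1 ++ w2) = P w].
Proof.
case/root_exchange; [exact: root_sroot|exact: sroot_base|].
move=> w1 [b [w2 [-> tw]]]; exists w1, b, w2; split=> //.
apply/funext=> x; rewrite /= !word_prod_cat /=.
by have /(congr1 (fun g => g (P w2 x))) := sroot_conj tw.
Qed.

(** * Reduced words and left descents *)

Lemma reduced_catl u w : reduced_word s (u ++ w) -> reduced_word s u.
Proof.
move=> rw v vu; have := rw (v ++ w); rewrite !size_cat leq_add2r; apply.
by apply/funext=> x; rewrite !word_prod_cat vu.
Qed.

Lemma reduced_catr u w : reduced_word s (u ++ w) -> reduced_word s w.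
Proof.
move=> rw v vw; have := rw (u ++ v); rewrite !size_cat leq_add2l; apply.
by apply/funext=> x; rewrite !word_prod_cat vw.
Qed.

Lemma reduced_rev w : reduced_word s w -> reduced_word s (rev w).
Proof.
move=> rw v /word_prod_rev; rewrite revK => /rw.
by rewrite !size_rev.
Qed.

Lemma reduced_eq u w :
  P u = P w -> size u = size w -> reduced_word s w -> reduced_word s u.
Proof. by move=> uw suw rw v; rewrite uw suw; apply: rw. Qed.

Lemma reduced_exists w : exists2 v, reduced_word s v & P v = P w.
Proof.
pose p k := `[< exists2 v, size v = k & P v = P w >].
have pw : exists k, p k by exists (size w); apply/asboolP; exists w.
have [k /asboolP[v vk vw] k_min] := ex_minnP pw.
exists v => // u uv; rewrite vk; apply: k_min.
by apply/asboolP; exists u; rewrite // uv.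
Qed.

Lemma reduced_cons_gt0 b w :
  reduced_word s (b :: w) -> 0 < sroot b (P w base).
Proof.
move=> rw; apply/negPn/negP.
rewrite -(root_base_le0 (root_word w (root_sroot D b))) => /exchange.
move=> [w1 [c [w2 [wE _ eqw]]]].
have := rw (w1 ++ w2); rewrite /= wE !size_cat /= addnS => /(_ _)/wrap[].
  apply/funext=> x; rewrite /= -wE.
  by rewrite -eqw /= (reflK D).
by rewrite ltnNge leqnSn.
Qed.

Lemma reduced_cons_lt0 b w :
  reduced_word s (b :: w) -> sroot b (P (b :: w) base) < 0.
Proof. by move/reduced_cons_gt0 => h; rewrite /= sroot_refl oppr_lt0. Qed.

Lemma descent_reduced t y : reduced_word s y -> sroot t (P y base) < 0 ->
  exists2 y', reduced_word s (t :: y') & P (t :: y') = P y.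
Proof.
move=> ry /exchange[w1 [b [w2 [yE _ eqy]]]].
exists (w1 ++ w2) => //; apply: reduced_eq eqy _ ry.
by rewrite yE /= !size_cat /= addnS.
Qed.

Lemma reduced_rcons_gt0 b w :
  reduced_word s (rcons w b) -> 0 < sroot b (P (rev w) base).
Proof.
by move/reduced_rev; rewrite rev_rcons => /reduced_cons_gt0.
Qed.

(** * Alternating words and dihedral subgroups *)

Lemma iter_reflC a b m x :
  s a (iter m (s b \o s a) x) = iter m (s a \o s b) (s a x).
Proof. by elim: m => //= m ->. Qed.

Lemma alternating_iter a b m x :
  P (alternating a b m) x = iter m (s a \o s b) (P (alternating b a m) x).
Proof.
elim: m a b x => // m IHm a b x; rewrite !alternatingS /= IHm iter_reflC.
by rewrite -[RHS]/(iter m.+1 (s a \o s b) _) iterSr /= (reflK D).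
Qed.

Lemma alternating_period a b m :
  P (alternating a b m) = P (alternating b a m) -> iter m (s a \o s b) =1 id.
Proof.
move=> ab x; rewrite -{1}[x](word_prod_revKr (alternating b a m)).
by rewrite -alternating_iter ab word_prod_revKr.
Qed.

Lemma iter_periodC a b m :
  iter m (s a \o s b) =1 id -> iter m (s b \o s a) =1 id.
Proof.
by move=> ab x; rewrite -{1}[x](reflK D b) -iter_reflC ab (reflK D).
Qed.

Lemma alternating_take a b p q :
  (q <= p)%N -> take q (alternating a b p) = alternating a b q.
Proof.
by move=> qp; rewrite /alternating /mkseq -map_take take_iota (minn_idPl qp).
Qed.

(** Exchange puts the descent [t] in front and deletes another letter. Were that letter inside the
    alternating prefix, two alternating words of some length [q <= p] would have the same product, a
    relation excluded by hypothesis. So the prefix survives and grows by [t]. *)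
Lemma alternating_step a t p y :
    reduced_word s y -> sroot t (P y base) < 0 ->
    (forall q, (0 < q <= p)%N -> ~ iter q (s a \o s t) =1 id) ->
    (exists2 z, reduced_word s (alternating a t p ++ z) &
       P (alternating a t p ++ z) = P y) ->
  exists2 z, reduced_word s (alternating t a p.+1 ++ z) &
    P (alternating t a p.+1 ++ z) = P y.
Proof.
move=> ry ty nper [z rz zy]; have tz := ty; rewrite -zy in tz.
have [w1 [b [w2 [zE tb eqz]]]] := exchange tz.
have [lt_w1p|le_pw1] := ltnP (size w1) p.
  have w1E : w1 ++ [:: b] = alternating a t (size w1).+1.
    have <- : take (size w1).+1 (alternating a t p ++ z) = w1 ++ [:: b].
      by rewrite zE -cat1s catA take_size_cat // size_cat addn1.
    by rewrite takel_cat ?size_mkseq // alternating_take.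
  have w1E' : w1 = alternating a t (size w1).
    rewrite -(@alternating_take _ _ (size w1).+1) // -w1E.
    by rewrite take_size_cat.
  case: (nper (size w1).+1) => //; apply: alternating_period.
  rewrite -w1E alternatingS -w1E' cats1.
  by apply/funext => x; rewrite word_prod_rcons;
    have /(congr1 (@^~ x)) := sroot_conj tb.
have altE : alternating a t p = take p w1.
  by move: (congr1 (take p) zE); rewrite take_cat size_mkseq ltnn subnn take0
    cats0 takel_cat.
exists (drop p w1 ++ w2).
  rewrite alternatingS altE cat_cons catA cat_take_drop.
  apply: reduced_eq eqz _ rz.
  by rewrite zE /= !size_cat /= addnS.
by rewrite alternatingS altE cat_cons catA cat_take_drop eqz.
Qed.

(* Two left descents of [y] generate a dihedral group whose longest element is
   a prefix of [y]. *)
Lemma dihedral_prefix a t p y :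
    reduced_word s y -> sroot a (P y base) < 0 ->
    sroot t (P y base) < 0 ->
    (forall q, (0 < q < p)%N -> ~ iter q (s a \o s t) =1 id) ->
  exists2 z, reduced_word s (alternating a t p ++ z) &
    P (alternating a t p ++ z) = P y.
Proof.
elim: p a t => [|p IHp] a t ry ay ty nper; first by exists y.
apply: alternating_step => // [q /andP[q0 qp] /iter_periodC|].
  by apply: nper; rewrite q0.
apply: IHp => // q /andP[q0 qp] /iter_periodC; apply: nper.
by rewrite q0 ltnW.
Qed.

(** * Descents of elements without braid moves *)

Lemma braidless_descents_commute a t y : reduced_word s y ->
    (forall w, reduced_word s w -> P w = P y -> ~ admits_braid_move s w) ->
    sroot a (P y base) < 0 -> sroot t (P y base) < 0 ->
  s t \o s a = s a \o s t.
Proof.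
move=> ry fcy ay ty; have dih := dihedral_prefix ry ay ty.
have := fcy _ _ _ (ex_intro _ a (ex_intro _ t (conj _ _))).
rewrite /coxeter_entry; case: pselect => [ex|nex].
  case: ex_minnP => m /asboolP[m0 per] m_min braid.
  (* The least period [m] is the Coxeter entry, so this prefix is one side of a braid move unless
     [m] is 1 or 2, and then the two reflections commute. *)
  have [z rz zy] : exists2 z, reduced_word s (alternating a t m ++ z) &
      P (alternating a t m ++ z) = P y.
    apply: dih => q /andP[q0 qm] perq.
    by have := m_min q (introT (asboolP _) (conj q0 perq)); rewrite leqNgt qm.
  have {braid}mlt3 : (m < 3)%N.
    rewrite ltnNge; apply/negP => m3; apply: (braid _ rz zy m3).
    exact: prefixW (prefix_prefix _ _).
  apply/funext=> x; have := per (s t (s a x)); case: m m0 per mlt3 {rz zy m_min}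
    => // -[|[|//]] _ per _ /=; rewrite !(reflK D) //.
  by move=> <-; rewrite -[LHS](per x).
(* For infinite order the dihedral prefix can be made longer than [y] itself. *)
move=> _; have [q /andP[q0 _] perq|z rz zy] := dih (size y).+1.
  by case: nex; exists q; apply/asboolP.
have := rz y (esym zy).
by rewrite size_cat size_mkseq addSn ltnNge leq_addr.
Qed.

(** The root [sroot t \o s a] is negated by [s t]. If positive at [base], it is [sroot t] by
    uniqueness; if negative, [sroot t] changes sign across [s a] and would be [sroot a]. *)
Lemma sroot_commute a t : s t \o s a = s a \o s t ->
  sroot t <> sroot a -> sroot t \o s a = sroot t.
Proof.
move=> ta neq; have r : root (sroot t \o s a).
  exact: root_comp (root_sroot D t).
have E x : sroot t (s a (s t x)) = - sroot t (s a x).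
  by rewrite -sroot_refl; congr (sroot t _); have /(congr1 (@^~ x)) := ta.
have [pos|] := boolP (0 < sroot t (s a base)).
  by apply: sroot_unique => //=; rewrite E oppr_lt0.
rewrite -(root_base_le0 r) => neg; case: neq.
exact: sroot_unique (root_sroot D t) (sroot_base D t) neg.
Qed.

Lemma braidless_not_in t v y :
    reduced_word s v -> reduced_word s y ->
    (forall w, reduced_word s w -> P w = P y -> ~ admits_braid_move s w) ->
    (forall f, root f -> 0 < f base -> f (P v base) < 0 -> f (P y base) < 0) ->
    sroot t (P y base) < 0 -> 0 < sroot t (P v base) ->
  t \notin v.
Proof.
elim: v y => // a v IHv y rv ry fcy sub ty tv.
have av := reduced_cons_lt0 rv.
have ay := sub _ (root_sroot D a) (sroot_base D a) av.
have neq : sroot t <> sroot a.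
  by move=> E; move: tv; rewrite E ltNge ltW.
have ta := sroot_commute (braidless_descents_commute ry fcy ay ty) neq.
have taE x : sroot t (s a x) = sroot t x by have /(congr1 (@^~ x)) := ta.
have [y' ry' yE] := descent_reduced ry ay.
have yE' : P y base = s a (P y' base) by rewrite -yE.
rewrite inE negb_or; apply/andP; split.
  by apply/eqP=> E; apply: neq; rewrite E.
have ry'a : reduced_word s y' := @reduced_catr [:: a] y' ry'.
apply: (IHv y').
- exact: (@reduced_catr [:: a] v rv).
- exact: ry'a.
- move=> w rw wy' [b [c [bc3 bc]]].
  have E : P (a :: w) = P (a :: y') by rewrite /= wy'.
  apply: (fcy (a :: w)); last 1 first.
  - by exists b, c; split=> //; apply: (@infix_catl _ _ _ [:: a]).
  - apply: reduced_eq E _ ry'; congr _.+1; apply/eqP.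
    by rewrite eqn_leq (rw y' (esym wy')) (ry'a w wy').
  - by rewrite E.
(* The inclusion for [a :: v] is applied to [f \o s a]. This fails only for [f = sroot a], which is
   not an inversion of [v] because [a :: v] is reduced. *)
- move=> f rf f_gt0 fv.
  have [pos|] := boolP (0 < f (s a base)).
    have := sub _ (root_comp a rf) pos; rewrite /= (reflK D) yE' (reflK D).
    exact.
  rewrite -(root_base_le0 (root_comp a rf)) => neg.
  have fa := sroot_unique rf f_gt0 neg.
  by have := reduced_cons_gt0 rv; rewrite -fa ltNge ltW.
- by rewrite -taE -yE'.
- by rewrite -taE.
Qed.

(** * Inversions of a finite reduced word *)

Lemma reduced_prefix_lt0 f w1 b w2 :
    reduced_word s (w1 ++ b :: w2) -> f \o P w1 = sroot b ->
  f (P (w1 ++ b :: w2) base) < 0.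
Proof.
move=> rw fb; rewrite word_prod_cat -[f _]/((f \o P w1) _) fb.
exact: reduced_cons_lt0 (reduced_catr rw).
Qed.

Lemma inversion_root_gt0 w1 b w2 :
  reduced_word s (w1 ++ b :: w2) -> 0 < (sroot b \o P (rev w1)) base.
Proof.
move=> rw; apply: reduced_rcons_gt0; apply: (@reduced_catl _ w2).
by rewrite cat_rcons.
Qed.

Lemma inversion_rootK w b : (sroot b \o P (rev w)) \o P w = sroot b.
Proof. by apply/funext=> x /=; rewrite word_prod_revK. Qed.

(** The root crossed at step [x] is still negative after [take y v], where the root about to be
    crossed is positive. *)
Lemma inversion_root_neq v (x y : nat) c :
    reduced_word s v -> (x < y < size v)%N ->
  sroot (nth c v x) \o P (rev (take x v)) <>
  sroot (nth c v y) \o P (rev (take y v)).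
Proof.
move=> rv /andP[xy yv] E.
have vx : take y v = take x v ++ nth c v x :: drop x.+1 (take y v).
  have xt : (x < size (take y v))%N by rewrite size_takel // ltnW.
  rewrite -{1}(cat_take_drop x (take y v)) (drop_nth c xt) nth_take //.
  by rewrite take_takel // ltnW.
have vy : v = take y v ++ nth c v y :: drop y.+1 v.
  by rewrite -drop_nth // cat_take_drop.
have ry : reduced_word s (take y v).
  by apply: (@reduced_catl _ (nth c v y :: drop y.+1 v)); rewrite -vy.
have := sroot_base D (nth c v y).
have := @reduced_prefix_lt0 (sroot (nth c v x) \o P (rev (take x v)))
  (take x v) (nth c v x) (drop x.+1 (take y v)).
rewrite -vx => /(_ ry (inversion_rootK _ _)); rewrite E /= word_prod_revK.
by move=> /ltW h; rewrite ltNge h.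
Qed.

Lemma reduced_size_le (A : eqType) (g : A -> V -> R) (S : seq A) v :
    reduced_word s v ->
    (forall v1 b v2, v = v1 ++ b :: v2 ->
      exists2 z, z \in S & sroot b \o P (rev v1) = g z) ->
  (size v <= size S)%N.
Proof.
move=> rv gS; case vE: v => [//|c v']; rewrite -vE {v' vE}.
have ex (x : 'I_(size v)) : exists z, z \in S /\
    sroot (nth c v x) \o P (rev (take x v)) = g z.
  have [|z zS E] := gS (take x v) (nth c v x) (drop x.+1 v); last by exists z.
  by rewrite -drop_nth // cat_take_drop.
have [h hP] := fin_all_exists ex.
have neq (x y : 'I_(size v)) : (x < y)%N -> h x <> h y.
  move=> xy hxy; apply: (@inversion_root_neq v x y c rv).
    by rewrite xy ltn_ord.
  by rewrite (hP x).2 (hP y).2 hxy.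
have h_inj : injective h.
  by move=> x y hxy; apply/val_inj; case: (ltngtP x y) => // /neq; rewrite hxy.
rewrite -(size_enum_ord (size v)) -(size_map h); apply: uniq_leq_size.
  by rewrite map_inj_uniq // enum_uniq.
by move=> _ /mapP[x _ ->]; apply: (hP x).1.
Qed.

Lemma reflection_root u b v c :
    0 < (sroot b \o P (rev u)) base -> 0 < (sroot c \o P (rev v)) base ->
  word_prod s (u ++ b :: rev u) = word_prod s (v ++ c :: rev v) <->
  sroot b \o P (rev u) = sroot c \o P (rev v).
Proof.
set f := _ \o _ => f_gt0; set g := _ \o _ => g_gt0; split=> [uv|fg].
  have fuE x : f (P (u ++ b :: rev u) x) = - f x.
    by rewrite /f /= word_prod_cat /= word_prod_revK sroot_refl.
  have rf : root (f \o P v) by apply/root_word/root_word/root_sroot.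
  have fvE x : f (P v (s c x)) = - f (P v x).
    by rewrite -fuE uv word_prod_cat /= word_prod_revK.
  have fE x : f x = (f \o P v) (P (rev v) x) by rewrite /= word_prod_revKr.
  have [pos|] := boolP (0 < (f \o P v) base).
    have fv : f \o P v = sroot c.
      by apply: sroot_unique => //=; rewrite fvE oppr_lt0.
    by apply/funext=> x; rewrite fE fv.
  rewrite -(root_base_le0 rf) => neg.
  have fv : (fun x => - (f \o P v) x) = sroot c.
    apply: sroot_unique; first exact: root_opp.
      by rewrite oppr_gt0.
    by rewrite /= fvE opprK.
  have gE x : g x = - f x by rewrite /g /= -fv /= word_prod_revKr.
  by move: g_gt0; rewrite gE oppr_gt0 ltNge ltW.
have /sroot_conj E : sroot b \o P (rev u ++ v) = sroot c.
  rewrite -(inversion_rootK v c) -/g -fg.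
  by apply/funext=> x /=; rewrite word_prod_cat.
apply/funext=> x; rewrite !word_prod_cat /=.
have /(congr1 (fun h => h (P (rev v) x))) := E.
rewrite /= !word_prod_cat word_prod_revKr => ->.
by rewrite word_prod_revKr.
Qed.

(** * Inversions of infinite words, read off at the chambers of their prefixes *)

Definition limit_inversion (k : infinite_reduced_word s) f :=
  exists m, f (P (mkseq k m) base) < 0.

Lemma irw_reduced (k : infinite_reduced_word s) m : reduced_word s (mkseq k m).
Proof. by case: k => k /= /asboolP. Qed.

Lemma mkseq_split (k : nat -> I) m d :
  mkseq k (m + d.+1) = mkseq k m ++ k m :: mkseq (fun x => k (m + x.+1)%N) d.
Proof.
rewrite /mkseq iotaD map_cat /= add0n; congr (_ ++ _ :: _).
rewrite -[m.+1]addn0 iotaDl -map_comp; apply: eq_map => x /=.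
by rewrite addSnnS.
Qed.

Lemma inversion_mkseq (k : nat -> I) f m :
    root f -> 0 < f base -> f (P (mkseq k m) base) < 0 ->
  exists2 m', (m' < m)%N & f = sroot (k m') \o P (rev (mkseq k m')).
Proof.
move=> rf f_gt0 /(root_exchange rf f_gt0)[w1 [b [w2 [mE fb]]]].
have ltm : (size w1 < m)%N.
  by rewrite -(size_mkseq k m) mE size_cat /= addnS ltnS leq_addr.
have /esym w1E := congr1 (take (size w1)) mE.
rewrite take_size_cat // /mkseq -map_take take_iota in w1E.
rewrite (minn_idPl (ltnW ltm)) in w1E.
have bE := congr1 (fun w => nth b w (size w1)) mE.
rewrite nth_cat ltnn subnn /= nth_mkseq // in bE.
exists (size w1) => //; rewrite bE -fb /mkseq -w1E.
by apply/funext=> x /=; rewrite word_prod_revKr.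
Qed.

Lemma limit_inversionP (k : infinite_reduced_word s) f :
    root f -> 0 < f base ->
  limit_inversion k f <->
  exists m, f = sroot (k m) \o P (rev (mkseq k m)).
Proof.
move=> rf f_gt0; split=> [[m /(inversion_mkseq rf f_gt0)[m' _ fE]]|[m ->]].
  by exists m'.
exists m.+1; rewrite -addn1 mkseq_split; apply: reduced_prefix_lt0.
  by rewrite -mkseq_split; apply: irw_reduced.
exact: inversion_rootK.
Qed.

Lemma limit_inversion_mono (k : infinite_reduced_word s) f m m' :
    root f -> 0 < f base -> (m <= m')%N ->
  f (P (mkseq k m) base) < 0 -> f (P (mkseq k m') base) < 0.
Proof.
move=> rf f_gt0 /subnKC <- /(root_exchange rf f_gt0)[w1 [b [w2 [mE fb]]]].
have E : mkseq k (m + (m' - m)) =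
    w1 ++ b :: (w2 ++ mkseq (fun x => k (m + x)%N) (m' - m)).
  by rewrite -cat_cons catA -mE /mkseq iotaD map_cat add0n -{2}[m]addn0 iotaDl
    -map_comp.
rewrite E; apply: reduced_prefix_lt0 fb; rewrite -E; exact: irw_reduced.
Qed.

Lemma inversion_set_sub (k l : infinite_reduced_word s) :
  (inversion_set k `<=` inversion_set l)%classic <->
  forall f, root f -> 0 < f base -> limit_inversion k f -> limit_inversion l f.
Proof.
have pos (h : infinite_reduced_word s) m :
    0 < (sroot (h m) \o P (rev (mkseq h m))) base.
  apply: (@inversion_root_gt0 _ _ [::]).
  by rewrite -(mkseq_split h m 0) ; apply: irw_reduced.
split=> [sub f rf f_gt0 /(limit_inversionP _ rf f_gt0)[m fE]|sub _ [m ->]].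
  have [|m'] := sub (P (mkseq k m ++ k m :: rev (mkseq k m))); first by exists m.
  move=> /(reflection_root (pos _ _) (pos _ _)) E.
  by apply/limit_inversionP => //; exists m'; rewrite fE.
have rf := root_word (rev (mkseq k m)) (root_sroot D (k m)).
have /(limit_inversionP _ rf (pos k m))[m' E] :
    limit_inversion l (sroot (k m) \o P (rev (mkseq k m))).
  by apply: sub => //; apply/limit_inversionP => //; exists m.
by exists m'; apply/reflection_root.
Qed.

(** A finite word has finitely many inversions, at most one per letter; by monotonicity, the largest
    of the indices at which they appear works for all. *)
Lemma limit_inversion_bound (k : infinite_reduced_word s) (w : seq I) :
    (forall f, root f -> 0 < f base -> f (P w base) < 0 ->
      limit_inversion k f) ->
  exists N, forall f m, root f -> 0 < f base -> f (P w base) < 0 ->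
    (N <= m)%N -> f (P (mkseq k m) base) < 0.
Proof.
move=> sub; pose F (x : 'I_(size w)) :=
  sroot (tnth (in_tuple w) x) \o P (rev (take x w)).
have [N HN] : exists N, forall x m, 0 < F x base ->
    F x (P w base) < 0 -> (N <= m)%N -> F x (P (mkseq k m) base) < 0.
  have ex x : exists m, 0 < F x base -> F x (P w base) < 0 ->
      F x (P (mkseq k m) base) < 0.
    have [F_gt0|] := boolP (0 < F x base); last by exists 0%N.
    have [F_lt0|] := boolP (F x (P w base) < 0); last by exists 0%N.
    have [m mP] := sub _ (root_word _ (root_sroot D _)) F_gt0 F_lt0.
    by exists m.
  have [g gP] := fin_all_exists ex.
  exists (\max_x g x)%N => x m F_gt0 F_lt0 Nm.
  apply: limit_inversion_mono (gP x F_gt0 F_lt0) => //.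
    exact: root_word (root_sroot D _).
  exact: leq_trans (leq_bigmax x) Nm.
exists N => f m rf f_gt0 fw.
have [w1 [b [w2 [wE fb]]]] := root_exchange rf f_gt0 fw.
have ltx : (size w1 < size w)%N by rewrite wE size_cat /= addnS ltnS leq_addr.
have fE : f = F (Ordinal ltx).
  rewrite /F (tnth_nth b) /= {1}wE nth_cat ltnn subnn /= wE.
  rewrite take_size_cat // -fb.
  by apply/funext=> x /=; rewrite word_prod_revKr.
by rewrite fE => Nm; apply: HN; rewrite -?fE.
Qed.

(** Beyond the root datum, affine type enters only through the bound on reduced words omitting a
    letter, which the finiteness of the maximal parabolic subgroups provides. *)
Theorem minimal_limit_element (k : infinite_reduced_word s) :
    (forall t, exists N, forall v, reduced_word s v -> t \notin v ->
      (size v <= N)%N) ->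
  fully_commutative_word k -> minimal_element (limit_class k).
Proof.
move=> bnd fck y; rewrite -[y]reprK -/(limit_class _); move: (repr y) => l.
move=> /limit_class_leP/inversion_set_sub lk; apply/limit_class_eq/seteqP.
split; apply/inversion_set_sub => // f rf f_gt0;
  move=> /(limit_inversionP _ rf f_gt0)[m].
elim/ltn_ind: m f rf f_gt0 => x IHx f rf f_gt0 fE.
apply: contrapT => nlf.
pose t := k x; pose u := mkseq k x.
have ul g : root g -> 0 < g base -> g (P u base) < 0 -> limit_inversion l g.
  move=> rg g_gt0 gu.
  by have [m' /IHx] := inversion_mkseq rg g_gt0 gu; apply.
have [N NP] := limit_inversion_bound ul.
have [B BP] := bnd t.
(* [N] gives [w] all inversions of [u], and [x + B.+1] makes u^-1 w longer than [B]. *)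
pose m := maxn N (x + B.+1); pose w := mkseq l m.
have wk g : root g -> 0 < g base -> g (P w base) < 0 -> limit_inversion k g.
  by move=> rg g_gt0 gw; apply: lk => //; exists m.
have [L LP] := limit_inversion_bound wk.
have [v rv vE] := reduced_exists (rev u ++ w).
(* The choice of [L] gives the prefix [u ++ y0] of [k] all inversions of [w]. *)
pose y0 := t :: mkseq (fun z => k (x + z.+1)%N) L.
have yE : mkseq k (x + L.+1) = u ++ y0 by apply: mkseq_split.
have ry : reduced_word s y0.
  by apply: (@reduced_catr u); rewrite -yE; apply: irw_reduced.
have vw z : P v z = P (rev u) (P w z) by rewrite vE word_prod_cat.
have : (size v <= B)%N.
  apply: (BP v rv); apply: (braidless_not_in rv ry).
  - move=> z rz zy [b [c [bc3 bc]]].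
    have uz : P (u ++ z) = P (mkseq k (x + L.+1)).
      by rewrite yE; apply/funext=> a; rewrite !word_prod_cat zy.
    apply: (fck (x + L.+1)%N _ (u ++ z)) => //; first by rewrite addnS.
      apply: (reduced_eq uz); last exact: irw_reduced.
      rewrite yE !size_cat; congr (_ + _)%N; apply/eqP.
      by rewrite eqn_leq (rz y0 (esym zy)) (ry z zy).
    by exists b, c; split=> //; apply: infix_catl.
  (* Pull [g] back along [u]. If positive at [base], the result is an inversion of [w], hence of
     [u ++ y0]. If negative, its opposite is an inversion of [u], hence of [w], which makes [g]
     positive at [v]. *)
  - move=> g rg g_gt0 gv.
    have rgu : root (g \o P (rev u)) by apply: root_word.
    have [pos|] := boolP (0 < (g \o P (rev u)) base).
      have Lle : (L <= x + L.+1)%N by rewrite addnS ltnW // ltnS leq_addl.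
      have := LP _ (x + L.+1)%N rgu pos.
      by rewrite /= -vw yE word_prod_cat word_prod_revK; apply.
    rewrite -(root_base_le0 rgu) => neg.
    have := NP _ m (root_opp rgu).
    rewrite /= oppr_gt0 word_prod_revK !oppr_lt0 -vw => /(_ neg g_gt0).
    by move=> /(_ (leq_maxl _ _)) gv_gt0; rewrite ltNge ltW in gv.
  - exact: reduced_cons_lt0 ry.
  - have fv : (sroot t \o P (rev u)) (P w base) = sroot t (P v base).
      by rewrite vw.
    apply/negPn/negP.
    rewrite -(root_base_le0 (root_word v (root_sroot D t))) /=.
    by rewrite -fv -fE => fw; apply: nlf; exists m.
(* As [u ++ v] has the same product as the reduced word [w], [v] has at least [m - x] letters, more
   than [B]. *)
have : (m <= x + size v)%N.
  rewrite -[m](size_mkseq l) -[x](size_mkseq k) -size_cat.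
  apply: irw_reduced; apply/funext => z.
  by rewrite word_prod_cat vw word_prod_revKr.
rewrite geq_max => /andP[_]; rewrite leq_add2l => /leq_trans h /h.
by rewrite ltnn.
Qed.

End RootDatum.

(** * The root datum of an affine Weyl group *)

Section Dot.
Context (R : realType) (n : nat).
Implicit Types (a b x y : 'rV[R]_n) (k l c : R).

Lemma dotC x y : dot x y = dot y x.
Proof. by apply: eq_bigr => j _; rewrite mulrC. Qed.

Lemma dotDr x a b : dot x (a + b) = dot x a + dot x b.
Proof. by rewrite -big_split; apply: eq_bigr => j _; rewrite mxE mulrDr. Qed.

Lemma dotZr x c a : dot x (c *: a) = c * dot x a.
Proof. by rewrite mulr_sumr; apply: eq_bigr => j _; rewrite mxE mulrCA. Qed.

Lemma dotNr x a : dot x (- a) = - dot x a.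
Proof. by rewrite -scaleN1r dotZr mulN1r. Qed.

Lemma dot0r x : dot x 0 = 0.
Proof. by rewrite -(scale0r 0) dotZr mul0r. Qed.

Lemma dotDl x y a : dot (x + y) a = dot x a + dot y a.
Proof. by rewrite !(dotC _ a) dotDr. Qed.

Lemma dotZl c x a : dot (c *: x) a = c * dot x a.
Proof. by rewrite !(dotC _ a) dotZr. Qed.

Lemma dotNl x a : dot (- x) a = - dot x a.
Proof. by rewrite !(dotC _ a) dotNr. Qed.

Lemma dot_sumr (I : finType) x (c : I -> R) (a : I -> 'rV[R]_n) :
  dot x (\sum_j c j *: a j) = \sum_j c j * dot x (a j).
Proof.
apply: (big_rec2 (fun u v => dot x u = v)); first by rewrite dot0r.
by move=> j u v _ <-; rewrite dotDr dotZr.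
Qed.

Lemma dot_eq0 x : dot x x = 0 -> x = 0.
Proof.
move=> /eqP; rewrite psumr_eq0 => [/allP x0|j _]; last first.
  by rewrite -expr2 sqr_ge0.
apply/rowP=> j; rewrite mxE; apply/eqP.
by have := x0 j (mem_index_enum _); rewrite mulf_eq0 orbb.
Qed.

(** * Affine forms and affine reflections *)

Definition affine_form a k x : R := dot x a - k.

Lemma affine_form_inj a k b l :
  affine_form a k = affine_form b l -> a = b /\ k = l.
Proof.
move=> E; have kl : k = l.
  have /(congr1 (@^~ 0)) := E; rewrite /affine_form !(dotC 0) !dot0r !sub0r.
  exact: oppr_inj.
split=> //; apply/eqP; rewrite -subr_eq0; apply/eqP/dot_eq0.
have /(congr1 (@^~ (a - b))) := E.
by rewrite /affine_form -kl => /addIr; rewrite dotDr dotNr => ->; rewrite subrr.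
Qed.

Lemma affine_reflectionE a k x :
  affine_reflection a k x = x - (2 * affine_form a k x / dot a a) *: a.
Proof. by []. Qed.

Lemma affine_reflectionN a k :
  affine_reflection (- a) (- k) = affine_reflection a k.
Proof.
apply/funext=> x; rewrite !affine_reflectionE /affine_form !dotNr dotNl.
by rewrite -opprD opprK scalerN -scaleNr mulrN mulNr opprK.
Qed.

(** Makes affine roots stable under reflections: for roots [a] and [b] the new direction is a root,
    and the constant moves by an integer multiple of [l]. *)
Lemma affine_form_reflection a k b l x :
  affine_form a k (affine_reflection b l x) =
  affine_form (affine_reflection b 0 a) (k - 2 * dot a b / dot b b * l) x.
Proof.
rewrite !affine_reflectionE /affine_form !(dotDl, dotNl, dotZl).
rewrite !(dotDr, dotNr, dotZr).
by rewrite (dotC a b) subr0; ring.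
Qed.

Lemma affine_reflection_root_form a k x : a != 0 ->
  affine_form a k (affine_reflection a k x) = - affine_form a k x.
Proof.
move=> a0; have aa : dot a a != 0 by apply: contra_neq a0 => /dot_eq0.
rewrite affine_reflectionE /affine_form dotDl dotNl dotZl.
by field.
Qed.

Lemma affine_reflectionK a k : a != 0 -> involutive (affine_reflection a k).
Proof.
move=> a0 x; rewrite affine_reflectionE affine_reflection_root_form //.
by rewrite affine_reflectionE mulrN mulNr scaleNr opprK subrK.
Qed.

Lemma dot_reflection b a : b != 0 ->
  dot (affine_reflection b 0 a) (affine_reflection b 0 a) = dot a a.
Proof.
move=> b0; have bb : dot b b != 0 by apply: contra_neq b0 => /dot_eq0.
rewrite !affine_reflectionE /affine_form.
rewrite !(dotDl, dotNl, dotZl, dotDr, dotNr, dotZr) (dotC b a).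
by field.
Qed.

Lemma affine_reflection_conj a k b l : b != 0 ->
  affine_reflection a k \o affine_reflection b l =
  affine_reflection b l \o affine_reflection (affine_reflection b 0 a)
    (k - 2 * dot a b / dot b b * l).
Proof.
move=> b0; have bb : dot b b != 0 by apply: contra_neq b0 => /dot_eq0.
apply/funext=> x /=; rewrite [LHS]affine_reflectionE affine_form_reflection.
rewrite [affine_reflection (affine_reflection b 0 a) _ x]affine_reflectionE
  dot_reflection //.
set c := (X in X *: a); rewrite (_ : 2 * _ / _ = c) //.
rewrite !affine_reflectionE /affine_form !(dotDl, dotNl, dotZl).
by apply/rowP=> j; rewrite !mxE; field.
Qed.
End Dot.

Section AffineWeyl.
Context (R : realType) (n : nat) (Phi : seq 'rV[R]_n).
Context (alpha : n.-tuple 'rV[R]_n) (theta : 'rV[R]_n).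
Context (hPhi : root_system Phi) (hred : reduced_roots Phi).
Context (hcrys : crystallographic Phi).
Context (halpha : simple_system Phi alpha).
Context (htheta : highest_root Phi alpha theta).

Local Notation s := (affine_simple_reflection alpha theta).

(** * Coweights and marks *)

Lemma root_opp_in a : a \in Phi -> - a \in Phi.
Proof.
move=> aP; have := root_refl hPhi aP aP.
rewrite /affine_reflection subr0 mulfK.
  by rewrite scaler_nat mulr2n opprD addNKr.
by apply: contraNneq (root_neq0 hPhi) => /dot_eq0 <-.
Qed.

Lemma root_nz a : a \in Phi -> a != 0.
Proof. by move=> aP; apply: contraNneq (root_neq0 hPhi) => <-. Qed.

Lemma alpha_in j : tnth alpha j \in Phi.
Proof. by apply: (simple_root halpha); apply: mem_tnth. Qed.

Lemma alpha_span x : x = \sum_j coord alpha j x *: tnth alpha j.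
Proof.
rewrite {1}(coord_basis (simple_basis halpha) (memvf x)).
by apply: eq_bigr => j _; rewrite (tnth_nth 0).
Qed.

Lemma alpha_separating x : (forall j, dot x (tnth alpha j) = 0) -> x = 0.
Proof.
move=> x0; apply: dot_eq0; rewrite {2}[x]alpha_span dot_sumr.
by apply: big1 => j _; rewrite x0 mulr0.
Qed.

(** The matrix whose columns are the simple roots is invertible because they span; the rows of its
    inverse form the dual basis. *)
Lemma coweight_exists : exists om : 'I_n -> 'rV[R]_n,
  forall j l, dot (om j) (tnth alpha l) = (j == l)%:R.
Proof.
pose A : 'M[R]_n := \matrix_(i, l) tnth alpha l 0 i.
have AE x l : (x *m A) 0 l = dot x (tnth alpha l).
  by rewrite mxE; apply: eq_bigr => i _; rewrite mxE.
have uA : A \in unitmx.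
  rewrite -row_free_unit; apply: inj_row_free => x xA; apply: alpha_separating.
  by move=> l; rewrite -AE xA mxE.
exists (fun j => delta_mx 0 j *m invmx A) => j l.
by rewrite -AE mulmxKV // mxE eqxx eq_sym.
Qed.

Definition coweight := sval (cid coweight_exists).

Lemma dot_coweight j l : dot (coweight j) (tnth alpha l) = (j == l)%:R.
Proof. exact: (svalP (cid coweight_exists)). Qed.

Lemma dot_coweight_sum j (c : 'I_n -> R) :
  dot (coweight j) (\sum_l c l *: tnth alpha l) = c j.
Proof.
rewrite dot_sumr (bigD1 j) //= dot_coweight eqxx mulr1 big1 ?addr0 // => l lj.
by rewrite dot_coweight eq_sym (negPf lj) mulr0.
Qed.

Lemma coweight_separating x : (forall j, dot (coweight j) x = 0) -> x = 0.
Proof.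
move=> x0; rewrite [x]alpha_span; apply: big1 => j _.
by rewrite -(dot_coweight_sum j (fun l => coord alpha l x)) -alpha_span x0
  scale0r.
Qed.

Lemma nneg_comb_coweight b j : nneg_comb alpha b -> 0 <= dot (coweight j) b.
Proof. by move=> [c ->]; rewrite dot_coweight_sum. Qed.

Definition mark j := dot (coweight j) theta.

Lemma mark_ge1 j : 1 <= mark j.
Proof.
have := nneg_comb_coweight j (htheta.2 _ (alpha_in j)).
by rewrite dotDr dotNr dot_coweight eqxx subr_ge0.
Qed.

Lemma mark_gt0 j : 0 < mark j.
Proof. exact: lt_le_trans ltr01 (mark_ge1 j). Qed.

Lemma mark_bound j a : a \in Phi -> dot (coweight j) a <= mark j.
Proof.
move=> aP; have := nneg_comb_coweight j (htheta.2 _ aP).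
by rewrite dotDr dotNr subr_ge0.
Qed.

(** * The fundamental alcove: vertices, walls and barycentre *)

Definition vertex (l : 'I_n.+1) : 'rV[R]_n :=
  if unlift ord0 l is Some j then (mark j)^-1 *: coweight j else 0.

(** Signs are chosen so that normals point into the alcove: the wall of s_0 gets the form 1 - (x,
    theta), positive inside like the others. *)
Definition simple_dir (l : 'I_n.+1) : 'rV[R]_n :=
  if unlift ord0 l is Some j then tnth alpha j else - theta.

Definition simple_off (l : 'I_n.+1) : R :=
  if unlift ord0 l is Some j then 0 else -1.

Lemma affine_simple_reflectionE l :
  s l = affine_reflection (simple_dir l) (simple_off l).
Proof.
rewrite /affine_simple_reflection /simple_dir /simple_off.
by case: unliftP => // _; rewrite affine_reflectionN.
Qed.

Lemma simple_dir_in l : simple_dir l \in Phi.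
Proof.
rewrite /simple_dir; case: unliftP => [j _|_]; first exact: alpha_in.
exact: root_opp_in htheta.1.
Qed.

Lemma simple_off_int l : simple_off l \is a Num.int.
Proof.
by rewrite /simple_off; case: unliftP; rewrite ?rpredN ?rpred0 ?rpred1.
Qed.

Lemma affine_form_vertex0 a k : affine_form a k (vertex ord0) = - k.
Proof.
by rewrite /vertex unlift_none /affine_form dotC dot0r sub0r.
Qed.

Lemma affine_form_vertexS a k j :
  affine_form a k (vertex (lift ord0 j)) = (mark j)^-1 * dot (coweight j) a - k.
Proof. by rewrite /vertex liftK /affine_form dotZl. Qed.

(** Up to positive scaling the simple forms are the barycentric coordinates of the alcove,
    [vertex l] being opposite to the wall of [l]. *)
Lemma simple_form_vertex l m :
  affine_form (simple_dir l) (simple_off l) (vertex m) =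
  affine_form (simple_dir l) (simple_off l) (vertex l) *+ (l == m).
Proof.
rewrite /simple_dir /simple_off.
case: (unliftP ord0 l) => [j|] ->; case: (unliftP ord0 m) => [j'|] ->.
- rewrite !affine_form_vertexS !dot_coweight (inj_eq lift_inj).
  have [->|ne] := eqVneq j j'; first by rewrite !eqxx.
  by rewrite mulr0 subr0.
- by rewrite affine_form_vertex0 oppr0.
- rewrite affine_form_vertexS dotNr -/(mark _) mulrN mulVf ?subrr //.
  exact: lt0r_neq0 (mark_gt0 _).
- by rewrite eqxx.
Qed.

Lemma simple_form_vertex_gt0 l :
  0 < affine_form (simple_dir l) (simple_off l) (vertex l).
Proof.
rewrite /simple_dir /simple_off.
case: (unliftP ord0 l) => [j|] ->; last first.
  by rewrite affine_form_vertex0 opprK ltr01.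
by rewrite affine_form_vertexS dot_coweight eqxx subr0 mulr1 invr_gt0 mark_gt0.
Qed.

Lemma vertex_separating a k :
  (forall l, affine_form a k (vertex l) = 0) -> a = 0 /\ k = 0.
Proof.
move=> f0; have k0 : k = 0.
  by have /eqP := f0 ord0; rewrite affine_form_vertex0 oppr_eq0 => /eqP.
split=> //; apply: coweight_separating => j.
have /eqP := f0 (lift ord0 j); rewrite affine_form_vertexS k0 subr0 mulf_eq0.
by rewrite invr_eq0 (negPf (lt0r_neq0 (mark_gt0 j))) => /eqP.
Qed.

(* The fundamental alcove, whose vertices these are, is not cut by the
   hyperplane of an affine root. *)
Lemma vertex_sign a k : a \in Phi -> k \is a Num.int ->
  (forall l, 0 <= affine_form a k (vertex l)) \/
  (forall l, affine_form a k (vertex l) <= 0).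
Proof.
move=> aP kint.
(* Maximality of [theta] bounds the linear part by 1 in absolute value, so a nonzero integer [k]
   decides the sign; for [k = 0] it is the sign of the root [a]. *)
have bnd l : - 1 <= affine_form a 0 (vertex l) <= 1.
  case: (unliftP ord0 l) => [j|] ->; last first.
    by rewrite affine_form_vertex0 oppr0 lerN10 ler01.
  rewrite affine_form_vertexS subr0 mulrC.
  rewrite ler_pdivlMr ?ler_pdivrMr ?mark_gt0 // mulN1r mul1r mark_bound //.
  by rewrite lerNl -dotNr mark_bound // root_opp_in.
have fE l : affine_form a k (vertex l) = affine_form a 0 (vertex l) - k.
  by rewrite /affine_form subr0.
have [k0|k0] := eqVneq k 0; last first.
  have := norm_intr_ge1 kint k0; rewrite ler_normr => /orP[k1|k1].
    right=> l; rewrite fE subr_le0; apply: le_trans k1.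
    by case/andP: (bnd l).
  left=> l; rewrite fE -lerBlDr sub0r.
  by apply: le_trans (proj1 (andP (bnd l))); rewrite lerNl opprK.
have sgn b : nneg_comb alpha b -> forall l, 0 <= affine_form b 0 (vertex l).
  move=> b0 l; case: (unliftP ord0 l) => [j|] ->.
    rewrite affine_form_vertexS subr0 mulr_ge0 ?nneg_comb_coweight //.
    by rewrite invr_ge0 ltW ?mark_gt0.
  by rewrite affine_form_vertex0 oppr0.
rewrite k0; have [/sgn|/sgn N0] := simple_comb halpha aP; first by left.
right=> l; have := N0 l.
by rewrite /affine_form dotNr !subr0 oppr_ge0.
Qed.

Definition alcove_center : 'rV[R]_n := n.+1%:R^-1 *: \sum_l vertex l.

Lemma alcove_centerE a k :
  affine_form a k alcove_center =
  n.+1%:R^-1 * \sum_l affine_form a k (vertex l).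
Proof.
rewrite /affine_form sumrB sumr_const card_ord -[k *+ _]mulr_natl mulrBr.
rewrite mulKf ?pnatr_eq0 // dotZl; congr (_ * _ - _).
rewrite dotC; apply: (big_rec2 (fun u v => dot a u = v)).
  by rewrite dot0r.
by move=> l u v _ <-; rewrite dotDr dotC.
Qed.

(** * Affine roots and the axioms of a root datum *)

Definition affine_root (f : 'rV[R]_n -> R) : Prop :=
  exists a k, [/\ a \in Phi, k \is a Num.int & f = affine_form a k].

Lemma affine_root_center_gt0 a k : a \in Phi -> k \is a Num.int ->
  0 < affine_form a k alcove_center ->
  forall l, 0 <= affine_form a k (vertex l).
Proof.
move=> aP kint; case: (vertex_sign aP kint) => // neg.
rewrite alcove_centerE pmulr_rgt0 ?invr_gt0 ?ltr0n // ltNge.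
by rewrite sumr_le0.
Qed.

Lemma affine_root_center_lt0 a k : a \in Phi -> k \is a Num.int ->
  affine_form a k alcove_center < 0 ->
  forall l, affine_form a k (vertex l) <= 0.
Proof.
move=> aP kint; case: (vertex_sign aP kint) => // pos.
rewrite alcove_centerE pmulr_rlt0 ?invr_gt0 ?ltr0n // ltNge.
by rewrite sumr_ge0.
Qed.

Lemma affine_root_opp f : affine_root f -> affine_root (fun x => - f x).
Proof.
move=> [a [k [aP kint ->]]]; exists (- a), (- k); split.
- exact: root_opp_in.
- by rewrite rpredN.
- by apply/funext=> x; rewrite /affine_form dotNr opprD.
Qed.

Lemma affine_root_reflection f l : affine_root f -> affine_root (f \o s l).
Proof.
move=> [a [k [aP kint ->]]]; rewrite affine_simple_reflectionE.
set b := simple_dir l.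
exists (affine_reflection b 0 a), (k - 2 * dot a b / dot b b * simple_off l).
split.
- exact: root_refl (simple_dir_in l) aP.
- rewrite rpredB // rpredM ?simple_off_int //.
  exact: hcrys (simple_dir_in l) aP.
- by apply/funext=> x /=; rewrite affine_form_reflection.
Qed.

(** The values at the vertices share a sign, so a zero average would make them all vanish and force
    [a = 0]. *)
Lemma affine_root_center f : affine_root f -> f alcove_center != 0.
Proof.
move=> [a [k [aP kint ->]]]; apply/eqP; rewrite alcove_centerE => /eqP.
rewrite mulf_eq0 invr_eq0 pnatr_eq0 /= => /eqP sum0.
have [] := @vertex_separating a k; last first.
  by move=> a0; have := root_nz aP; rewrite a0 eqxx.
move=> l; have [pos|neg] := vertex_sign aP kint.
  apply/eqP; move/eqP: sum0; rewrite psumr_eq0 //.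
  by move=> /allP/(_ l (mem_index_enum l)).
apply/eqP; move/eqP: sum0; rewrite -oppr_eq0 -sumrN psumr_eq0 => [|j _];
  last by rewrite oppr_ge0.
by move=> /allP/(_ l (mem_index_enum l)); rewrite /= oppr_eq0.
Qed.

Definition simple_form l := affine_form (simple_dir l) (simple_off l).

Lemma affine_root_simple l : affine_root (simple_form l).
Proof.
exists (simple_dir l), (simple_off l).
by split; [apply: simple_dir_in | apply: simple_off_int |].
Qed.

Lemma simple_form_center l : 0 < simple_form l alcove_center.
Proof.
rewrite /simple_form alcove_centerE pmulr_rgt0 ?invr_gt0 ?ltr0n //.
rewrite (bigD1 l) //= big1 ?addr0 ?simple_form_vertex_gt0 // => m ml.
by rewrite simple_form_vertex eq_sym (negPf ml).
Qed.

Lemma simple_form_reflection l x : simple_form l (s l x) = - simple_form l x.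
Proof.
rewrite affine_simple_reflectionE /simple_form affine_reflection_root_form //.
exact/root_nz/simple_dir_in.
Qed.

Lemma affine_simple_reflectionK l : involutive (s l).
Proof.
rewrite affine_simple_reflectionE; apply: affine_reflectionK.
exact/root_nz/simple_dir_in.
Qed.

Lemma reflection_vertex l m : m != l -> s l (vertex m) = vertex m.
Proof.
move=> ml; rewrite affine_simple_reflectionE affine_reflectionE.
by rewrite simple_form_vertex eq_sym (negPf ml) mulr0 mul0r scale0r subr0.
Qed.

(** At the vertices [f] is nonnegative and [f \o s l] nonpositive. Since [s l] fixes all vertices
    but [vertex l], [f] vanishes at those and is a multiple of [simple_form l]. Reducedness leaves
    the factors 1 and -1, and the sign at [vertex l] excludes -1. *)
Lemma simple_form_unique f l : affine_root f -> 0 < f alcove_center ->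
  f (s l alcove_center) < 0 -> f = simple_form l.
Proof.
move=> rf; have := affine_root_reflection l rf.
move: rf => [a [k [aP kint fE]]] [b [m [bP mint sE]]] f_gt0 f_lt0.
have pos := affine_root_center_gt0 aP kint; rewrite -fE in pos.
have neg := affine_root_center_lt0 bP mint; rewrite -sE /= in neg.
have f0 j : j != l -> f (vertex j) = 0.
  move=> jl; apply/le_anti; rewrite (pos f_gt0) andbT.
  by rewrite -{1}(reflection_vertex jl) (neg f_lt0).
set e := simple_form l (vertex l).
have e_gt0 : 0 < e := simple_form_vertex_gt0 l.
pose c := f (vertex l) / e.
have [aE kE] : a - c *: simple_dir l = 0 /\ k - c * simple_off l = 0.
  apply: vertex_separating => j.
  have -> : affine_form (a - c *: simple_dir l) (k - c * simple_off l)
      (vertex j) =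
      f (vertex j) - c * simple_form l (vertex j).
    rewrite fE /simple_form /affine_form dotDr dotNr dotZr; ring.
  have [->|jl] := eqVneq j l; first by rewrite divfK ?subrr ?lt0r_neq0.
  rewrite f0 // /simple_form simple_form_vertex eq_sym (negPf jl).
  by rewrite mulr0 subr0.
move/eqP: aE; rewrite subr_eq0 => /eqP aE.
move/eqP: kE; rewrite subr_eq0 => /eqP kE.
have c0 : 0 <= c by rewrite divr_ge0 ?pos // ltW.
have [c1|c1] : c = 1 \/ c = -1.
  by apply: (hred (simple_dir_in l)); rewrite -aE.
  by rewrite fE aE kE c1 scale1r mul1r.
by move: c0; rewrite c1 ler0N1.
Qed.

(** Form and reflection are carried along with the same [b] and [m], so that [simple_form_conj] can
    turn an equality of forms into one of reflections. *)
Lemma affine_form_conj w a k : exists b m,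
  affine_form a k \o word_prod s w = affine_form b m /\
  affine_reflection a k \o word_prod s w =
    word_prod s w \o affine_reflection b m.
Proof.
elim: w a k => [|l w IHw] a k; first by exists a, k.
set a1 := affine_reflection (simple_dir l) 0 a.
set k1 := k - 2 * dot a (simple_dir l) /
  dot (simple_dir l) (simple_dir l) * simple_off l.
have [b [m [fE rE]]] := IHw a1 k1.
exists b, m; split.
  rewrite -fE; apply/funext=> x /=.
  by rewrite {1}affine_simple_reflectionE affine_form_reflection.
apply/funext=> x /=; have /(congr1 (@^~ x))/= <- := rE.
rewrite affine_simple_reflectionE.
have := affine_reflection_conj a k (simple_off l) (root_nz (simple_dir_in l)).
by move=> /(congr1 (@^~ (word_prod s w x))).
Qed.

Lemma simple_form_conj i j w : simple_form i \o word_prod s w = simple_form j ->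
  s i \o word_prod s w = word_prod s w \o s j.
Proof.
have [b [m [fE rE]]] := affine_form_conj w (simple_dir i) (simple_off i).
rewrite {1}/simple_form fE => /affine_form_inj[bE mE].
by rewrite !affine_simple_reflectionE rE bE mE.
Qed.

Definition affine_root_datum : root_datum R s :=
  RootDatum affine_simple_reflectionK affine_root_opp affine_root_reflection
    affine_root_center affine_root_simple simple_form_center
    simple_form_reflection simple_form_unique simple_form_conj.

(* A word avoiding the letter [t] fixes the vertex opposite to the wall of [t],
   through which at most one root hyperplane passes in each direction. *)
Lemma parabolic_reduced_bound t v : reduced_word s v -> t \notin v ->
  (size v <= size Phi)%N.
Proof.
move=> rv tv; pose g a := affine_form a (dot (vertex t) a).
apply: (@reduced_size_le _ _ _ _ affine_root_datum _ g Phi v rv).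
move=> v1 b v2 vE /=.
have [a [k [aP _ fE]]] : affine_root (simple_form b \o word_prod s (rev v1)).
  exact: (root_word (D := affine_root_datum)) (affine_root_simple b).
(* The hyperplane passes through [vertex t], which is fixed by [rev v1] and lies on the wall of [b];
   hence [a] determines [k]. *)
exists a => //; rewrite fE /g; congr affine_form; apply/eqP.
have := congr1 (@^~ (vertex t)) fE; rewrite /affine_form /=.
have fix_t w : t \notin w -> word_prod s w (vertex t) = vertex t.
  elim: w => //= l w IHw; rewrite inE negb_or => /andP[tl tw].
  by rewrite IHw // reflection_vertex.
move: tv; rewrite vE mem_cat inE !negb_or => /and3P[tv1 tb _].
rewrite fix_t ?mem_rev // /simple_form simple_form_vertex (eq_sym b).
by rewrite (negPf tb) => /esym/eqP; rewrite subr_eq0 eq_sym.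
Qed.

End AffineWeyl.

Theorem corollary5p2 (R : realType) (n : nat) (Phi : seq 'rV[R]_n)
    (alpha : n.-tuple 'rV[R]_n) (theta : 'rV[R]_n)
    (hPhi : root_system Phi) (hred : reduced_roots Phi)
    (hcrys : crystallographic Phi) (hirr : irreducible_roots Phi)
    (halpha : simple_system Phi alpha) (htheta : highest_root Phi alpha theta)
    (i : infinite_reduced_word (affine_simple_reflection alpha theta)) :
  fully_commutative_word i -> minimal_element (limit_class i).
Proof.
apply: (minimal_limit_element
  (affine_root_datum hPhi hred hcrys halpha htheta)).
move=> t; exists (size Phi) => v.
exact: parabolic_reduced_bound.
Qed.
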